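(* Let $\alpha>0$, $x_0,y_0\in\mathbb R$, and let $(X_t,Y_t)_{t\ge 0}$ be the solution of the linear stochastic oscillator $$\mathrm dX_t=Y_t\,\mathrm dt,\qquad \mathrm dY_t=-X_t\,\mathrm dt+\alpha\,\mathrm dW_t,\qquad (X_0,Y_0)=(x_0,y_0).$$ For $T>0$ let $B_T=\frac{X_T}{T}$ be the mean velocity. Then $\{B_T\}_{T>0}$ satisfies a large deviations principle (as $T\to\infty$, with speed $T$) with the good rate function $J(y)=\frac{y^2}{\alpha^2}$, $y\in\mathbb R$.
   Context: $W=(W_t)_{t\ge0}$ is a one-dimensional standard Brownian motion on a complete filtered probability space $(\Omega,\mathscr F,\{\mathscr F_t\}_{t\ge0},\mathbf P)$. The solution component $X_t$ is explicitly $X_t=x_0\cos(t)+y_0\sin(t)+\alpha\int_0^t\sin(t-s)\,\mathrm dW_s$. A rate function on $\mathbb R$ is a lower semicontinuous function $J:\mathbb R\to[0,\infty]$; it is good if all level sets $\{y: J(y)\le a\}$, $a\in[0,\infty)$, are compact. A family of real random variables $\{Z_T\}_{T>0}$ satisfies a large deviations principle with rate function $J$ if $\liminf_{T\to\infty}\frac1T\log\mathbf P(Z_T\in U)\ge-\inf_{y\in U}J(y)$ for every open $U\subset\mathbb R$ and $\limsup_{T\to\infty}\frac1T\log\mathbf P(Z_T\in C)\le-\inf_{y\in C}J(y)$ for every closed $C\subset\mathbb R$. Conventions: $\log 0=-\infty$, $\inf\emptyset=+\infty$. *)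

(* Defs.v *)
From HB Require Import structures.
From mathcomp Require Import all_boot all_order all_algebra.
From mathcomp Require Import all_classical all_reals all_analysis.
Import Order.TTheory GRing.Theory Num.Theory.
Import numFieldNormedType.Exports.

Set Implicit Arguments.
Unset Strict Implicit.
Unset Printing Implicit Defensive.

Local Open Scope classical_set_scope.
Local Open Scope ring_scope.

(* Processes are functions [R -> Omega -> R], and filtrations are functions
   [R -> set (set Omega)]; only their values at times t >= 0 matter. *)

(* Sub-sigma-algebras are collections of sets, since a [measurableType] carries
   a single sigma-algebra.  Right-continuity of the filtration is not required. *)
Record complete_filtration (R : realType) (d : measure_display)
    (Omega : measurableType d) (P : probability Omega R)
    (F : R -> set (set Omega)) : Prop := CompleteFiltration {
  filtration_sigma_algebra : forall t : R, 0 <= t -> sigma_algebra setT (F t) ;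
  filtration_measurable : forall t : R, 0 <= t -> F t `<=` measurable ;
  filtration_nondecreasing : forall s t : R, 0 <= s -> s <= t -> F s `<=` F t ;
  filtration_measure_complete : measure_is_complete P ;
  filtration_negligible : P.-negligible `<=` F 0 }.

Definition adapted (R : realType) (d : measure_display)
    (Omega : measurableType d) (F : R -> set (set Omega))
    (X : R -> Omega -> R) : Prop :=
  forall t : R, 0 <= t -> forall B : set R, measurable B -> F t (X t @^-1` B).

Definition continuous_paths (R : realType) (d : measure_display)
    (Omega : measurableType d) (P : probability Omega R)
    (X : R -> Omega -> R) : Prop :=
  {ae P, forall w, {within `[0, +oo[, continuous (fun t => X t w)}}.

(* The second parameter of [normal_prob] is the standard deviation. *)
Record brownian_motion (R : realType) (d : measure_display)
    (Omega : measurableType d) (P : probability Omega R)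
    (F : R -> set (set Omega)) (W : R -> Omega -> R) : Prop := BrownianMotion {
  brownian_adapted : adapted F W ;
  brownian_start : {ae P, forall w, W 0 w = 0} ;
  brownian_continuous : continuous_paths P W ;
  brownian_gaussian : forall s t : R, 0 <= s -> s < t ->
    forall B : set R, measurable B ->
      P [set w | B (W t w - W s w)] = normal_prob 0 (Num.sqrt (t - s)) B ;
  brownian_independent : forall s t : R, 0 <= s -> s < t ->
    forall (A : set Omega) (B : set R), F s A -> measurable B ->
      P (A `&` [set w | B (W t w - W s w)]) =
      (P A * P [set w | B (W t w - W s w)%R])%E }.

(* The SDE in integral form.  The noise is additive, so the stochastic integral
   of the constant alpha over [0, t] is alpha * W_t, and t = 0 gives the initial
   condition.  The null set is common to all times. *)
Record oscillator_solution (R : realType) (d : measure_display)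
    (Omega : measurableType d) (P : probability Omega R)
    (F : R -> set (set Omega)) (W : R -> Omega -> R) (alpha x0 y0 : R)
    (X Y : R -> Omega -> R) : Prop := OscillatorSolution {
  oscillator_adapted_X : adapted F X ;
  oscillator_adapted_Y : adapted F Y ;
  oscillator_continuous_X : continuous_paths P X ;
  oscillator_continuous_Y : continuous_paths P Y ;
  oscillator_X : {ae P, forall w, forall t : R, 0 <= t ->
    X t w = x0 + \int[lebesgue_measure]_(s in `[0, t]) Y s w} ;
  oscillator_Y : {ae P, forall w, forall t : R, 0 <= t ->
    Y t w = y0 - \int[lebesgue_measure]_(s in `[0, t]) X s w
            + alpha * W t w} }.

Definition rate_function (R : realType) (J : R -> \bar R) : Prop :=
  (forall y : R, (0 <= J y)%E) /\ lower_semicontinuous J.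

Definition good_rate_function (R : realType) (J : R -> \bar R) : Prop :=
  rate_function J /\
  forall a : R, 0 <= a -> compact [set y | (J y <= a%:E)%E].

(* [lne 0 = -oo] and [ereal_inf set0 = +oo]; [limf_einf] and [limf_esup] along
   [+oo] only depend on large (in particular positive) values of T. *)
Record large_deviations_principle (R : realType) (d : measure_display)
    (Omega : measurableType d) (P : probability Omega R)
    (Z : R -> Omega -> R) (J : R -> \bar R) : Prop := LargeDeviationsPrinciple {
  ldp_random_variable : forall T : R, 0 < T -> measurable_fun setT (Z T) ;
  ldp_rate_function : rate_function J ;
  ldp_lower_bound : forall U : set R, open U ->
    (- ereal_inf [set J y | y in U] <=
     limf_einf (fun T : R => (T^-1)%:E * lne (P (Z T @^-1` U))) +oo%R)%E ;
  ldp_upper_bound : forall C : set R, closed C ->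
    (limf_esup (fun T : R => (T^-1)%:E * lne (P (Z T @^-1` C))) +oo%R <=
     - ereal_inf [set J y | y in C])%E }.

(* Main.v *)
(** Solving the oscillator path by path, [X_T] is the limit of
    [x0 cos T + y0 sin T + alpha * S_n], where [S_n] is the Riemann-Ito sum of
    [sin (T - .)] against the increments of [W].  Independence of the
    increments gives the moment generating function of [S_n]; the exponentials
    are uniformly integrable because their second moments converge, so
    [E (exp (l X_T)) = exp (l m_T + l^2 s_T / 2)] with [m_T] bounded and
    [s_T = alpha^2 (T - sin T cos T) / 2 = alpha^2 T / 2 + O(1)].
    The upper bound is then Chernoff's inequality, and the lower bound follows
    by exponential tilting: under the density proportional to [exp (l X_T)]
    with [l = 2 y / alpha^2], [X_T / T] concentrates around [y]. *)

Require Import Defs.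
From mathcomp Require Import all_boot all_order all_algebra.
From mathcomp Require Import all_classical all_reals all_analysis.
From mathcomp Require Import measurable_realfun ring lra.
Import Order.TTheory GRing.Theory Num.Theory.
Import numFieldNormedType.Exports.

Local Open Scope classical_set_scope.
Local Open Scope ring_scope.

(** * Moment generating functions and large deviations *)

Lemma limf_einf_ge (R : realType) (f : R -> \bar R) (a : \bar R) :
  (\forall T \near +oo, (a <= f T)%E) -> (a <= limf_einf f +oo%R)%E.
Proof.
move=> af; rewrite limf_einfE.
apply: (@le_trans _ _ (ereal_inf (f @` [set T | (a <= f T)%E]))).
  by apply: le_ereal_inf_tmp => _ [T afT <-].
by apply: ereal_sup_ubound; exists [set T | (a <= f T)%E].
Qed.

Lemma limf_esup_le (R : realType) (f : R -> \bar R) (a : \bar R) :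
  (\forall T \near +oo, (f T <= a)%E) -> (limf_esup f +oo%R <= a)%E.
Proof.
move=> fa; rewrite limf_esupE.
apply: (@le_trans _ _ (ereal_sup (f @` [set T | (f T <= a)%E]))).
  by apply: ereal_inf_lbound; exists [set T | (f T <= a)%E].
by apply: ge_ereal_sup => _ [T afT <-].
Qed.

Lemma exponential_markov (d : measure_display) (Omega : measurableType d)
    (R : realType) (P : probability Omega R) (Y : Omega -> R) (a : R) :
  measurable_fun setT Y ->
  (P [set w | (a <= Y w)%R]
   <= (expR (- a))%:E * \int[P]_w (expR (Y w))%:E)%E.
Proof.
move=> mY.
have mA : measurable [set w | a <= Y w].
  rewrite (_ : [set w | _] = setT `&` Y @^-1` `[a, +oo[%classic); first exact: mY.
  by rewrite setTI; apply/seteqP; split => w /=; rewrite in_itv/= andbT.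
have mE : measurable_fun setT (fun w => (expR (Y w))%:E : \bar R).
  by apply/measurable_EFinP; apply: measurableT_comp.
rewrite expRN muleC lee_pdivlMr ?expR_gt0//.
rewrite muleC -[X in P X]setIT -integral_cst//=; last exact: measurableI.
rewrite setIT.
apply: (@le_trans _ _ (\int[P]_(w in [set w | (a <= Y w)%R]) (expR (Y w))%:E)%E).
  apply: ge0_le_integral => //=.
  - exact: measurable_funTS.
  - by move=> w aY; rewrite lee_fin ler_expR.
exact: ge0_subset_integral.
Qed.

(* On [|x - y| < delta] the first term dominates; beyond [y + delta] and below
   [y - delta] the last two do. *)
Lemma exponential_tilting (R : realType) (l mu y delta x : R) : 0 <= mu ->
  expR (l * x) <= expR (l * y + `|l| * delta) * (`|x - y| < delta)%R%:R
    + expR (- (mu * (y + delta))) * expR ((l + mu) * x)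
    + expR (mu * (y - delta)) * expR ((l - mu) * x).
Proof.
move=> mu0; rewrite -!expRD.
have [xy|] := ltP `|x - y| delta.
  rewrite mulr1 -addrA ler_wpDr ?addr_ge0 ?expR_ge0// ler_expR.
  rewrite -lerBlDl -mulrBr (le_trans (ler_norm _))// normrM.
  by rewrite ler_wpM2l// ltW.
rewrite mulr0 add0r ler_normr => /orP[xy|xy].
  rewrite ler_wpDr ?expR_ge0// ler_expR.
  have : 0 <= mu * (x - y - delta) by rewrite mulr_ge0// subr_ge0.
  by lra.
rewrite ler_wpDl ?expR_ge0// ler_expR.
have : 0 <= mu * (- (x - y) - delta) by rewrite mulr_ge0// subr_ge0.
by lra.
Qed.

(** Integral of [exponential_tilting]: the two tail terms become moment generating functions at the
    shifted tilts [l + mu] and [l - mu], known by hypothesis. A lower bound for the probability of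
    the ball follows without introducing the tilted measure. *)
Lemma gaussian_mgf_ball (d : measure_display) (Omega : measurableType d)
    (R : realType) (P : probability Omega R) (Y : Omega -> R) (m s : R)
    (l mu y delta : R) :
  measurable_fun setT Y ->
  (forall l, \int[P]_w (expR (l * Y w))%:E =
             (expR (l * m + l ^+ 2 * s / 2))%:E)%E ->
  0 <= mu ->
  ((expR (l * m + l ^+ 2 * s / 2))%:E <=
   (expR (l * y + `|l| * delta))%:E * P [set w | (`|Y w - y| < delta)%R]
   + (expR ((l + mu) * m + (l + mu) ^+ 2 * s / 2 - mu * (y + delta)))%:E
   + (expR ((l - mu) * m + (l - mu) ^+ 2 * s / 2 + mu * (y - delta)))%:E)%E.
Proof.
move=> mY mgf mu0.
have mA : measurable [set w | `|Y w - y| < delta].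
  rewrite (_ : [set w | _] = setT `&` (fun w => `|Y w - y|) @^-1` `]-oo, delta[%classic).
    by apply: measurableT_comp => //; exact: measurable_funB.
  by rewrite setTI; apply/seteqP; split => w /=; rewrite in_itv/=.
have mE (k : R) : measurable_fun setT (fun w => (expR (k * Y w))%:E : \bar R).
  apply/measurable_EFinP; apply: measurableT_comp => //.
  exact: measurable_funM.
have E0 (k : R) : (forall w, setT w -> 0 <= (expR (k * Y w))%:E)%E.
  by move=> w _; rewrite lee_fin expR_ge0.
have mgfD (k b : R) : ((expR (k * m + k ^+ 2 * s / 2 + b))%:E =
    (expR b)%:E * \int[P]_w (expR (k * Y w))%:E)%E.
  by rewrite mgf -EFinM -expRD addrC.
rewrite (mgfD (l + mu)) (mgfD (l - mu)) -(mgf l).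
rewrite -!ge0_integralZl ?lee_fin ?expR_ge0//.
have mZ (a k : R) : measurable_fun setT (fun w => (a%:E * (expR (k * Y w))%:E)%E).
  exact: emeasurable_funM.
have Z0 (a k : R) : 0 <= a ->
    (forall w, setT w -> 0 <= a%:E * (expR (k * Y w))%:E)%E.
  by move=> a0 w _; rewrite -EFinM lee_fin mulr_ge0// expR_ge0.
have -> : P [set w | (`|Y w - y| < delta)%R] =
    (\int[P]_w (\1_[set w | (`|Y w - y| < delta)%R] w)%:E)%E.
  by rewrite integral_indic// setIT.
rewrite -ge0_integralZl ?lee_fin ?expR_ge0//; last first.
  exact/measurable_EFinP/measurable_indic.
have mI : measurable_fun setT (fun w => ((expR (l * y + `|l| * delta))%:E *
    (\1_[set w | (`|Y w - y| < delta)%R] w)%:E)%E).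
  by apply: emeasurable_funM => //; exact/measurable_EFinP/measurable_indic.
have I0 : forall w, setT w -> (0 <= (expR (l * y + `|l| * delta))%:E *
    (\1_[set w | (`|Y w - y| < delta)%R] w)%:E)%E.
  by move=> w _; rewrite -EFinM lee_fin mulr_ge0// expR_ge0.
rewrite -ge0_integralD//.
rewrite -ge0_integralD//; last 2 first.
- by move=> w _; rewrite adde_ge0 ?I0 ?Z0 ?expR_ge0.
- exact: emeasurable_funD.
apply: ge0_le_integral => //.
- by do !apply: emeasurable_funD.
- move=> w _; rewrite -!EFinM -!EFinD lee_fin indicE.
  have -> : (w \in [set w | `|Y w - y| < delta]) = (`|Y w - y| < delta) :> bool.
    by apply/idP/idP; rewrite inE.
  exact: exponential_tilting.
Qed.

Lemma scaled_lne_le (R : realType) (T x : R) (p : \bar R) :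
  0 < T -> (0 <= p)%E -> (p <= (expR x)%:E)%E ->
  ((T^-1)%:E * lne p <= (x / T)%:E)%E.
Proof.
move=> T0 p0 px; rewrite mulrC EFinM lee_pmul2l ?lte_fin ?invr_gt0//.
by rewrite -[leRHS]expeRK lee_lne//= in_itv/= ?leey ?andbT.
Qed.

Lemma scaled_lne_ge (R : realType) (T x : R) (p : \bar R) :
  0 < T -> ((expR x)%:E <= p)%E ->
  ((x / T)%:E <= (T^-1)%:E * lne p)%E.
Proof.
move=> T0 xp; rewrite mulrC EFinM lee_pmul2l ?lte_fin ?invr_gt0//.
have e0 : (0 <= (expR x)%:E)%E by rewrite lee_fin expR_ge0.
by rewrite -[leLHS]expeRK lee_lne//= in_itv/= ?leey ?andbT// (le_trans _ xp).
Qed.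

Lemma quadratic_good_rate_function (R : realType) (c : R) : 0 < c ->
  good_rate_function (fun y : R => (y ^+ 2 / c)%:E).
Proof.
move=> c0; split; first split.
- by move=> y; rewrite lee_fin divr_ge0 ?sqr_ge0 ?ltW.
- apply/lower_semicontinuousP => a.
  rewrite (_ : [set x | _] = (fun y : R => y ^+ 2 / c) @^-1` `]a, +oo[%classic).
    apply: open_comp => [y _|]; last exact: interval_open.
    by apply: cvgM; [exact: exprn_continuous|exact: cvg_cst].
  by apply/seteqP; split => y /=; rewrite in_itv/= andbT lte_fin.
- move=> a a0.
  rewrite (_ : [set y | _] = `[- Num.sqrt (a * c), Num.sqrt (a * c)]%classic).
    exact: segment_compact.
  have ac0 : 0 <= a * c by rewrite mulr_ge0// ltW.
  have E y : (y ^+ 2 / c <= a) = (`|y| <= Num.sqrt (a * c)).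
    by rewrite ler_pdivrMr// -(real_normK (num_real y)) -{1}(sqr_sqrtr ac0)
      ler_pXn2r// nnegrE ?sqrtr_ge0.
  by apply/seteqP; split => y /=; rewrite lee_fin E in_itv/= ler_norml.
Qed.

(** * Large deviations from an asymptotically linear log-moment generating function *)

Section gaussian_ldp.
Context (d : measure_display) (Omega : measurableType d) (R : realType)
  (P : probability Omega R) (X : R -> Omega -> R) (m s : R -> R) (c m0 k : R).
Hypothesis c0 : 0 < c.
Hypothesis mX : forall T : R, 0 < T -> measurable_fun setT (X T).
Hypothesis mgf : forall T l : R, 0 < T ->
  (\int[P]_w (expR (l * X T w))%:E =
   (expR (l * m T + l ^+ 2 * s T / 2))%:E)%E.
Hypothesis m_bounded : forall T : R, 0 < T -> `|m T| <= m0.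
Hypothesis s_linear : forall T : R, 0 < T -> `|s T - c * T| <= k.

Let mXT (T : R) : 0 < T -> measurable_fun setT (fun w => X T w / T).
Proof. by move=> T0; apply: measurable_funM => //; exact: mX. Qed.

Let measurable_preimage (T : R) (A : set R) : 0 < T -> measurable A ->
  measurable ((fun w => X T w / T) @^-1` A).
Proof. by move=> T0 mA; rewrite -[X in measurable X]setTI; exact: mXT. Qed.

Let half_tail (T l x : R) : 0 < T ->
  (P [set w | (x <= l * X T w)%R] <=
   (expR (- x + (`|l| * m0 + l ^+ 2 * (c * T + k) / 2)))%:E)%E.
Proof.
move=> T0.
have ml : measurable_fun setT (fun w => l * X T w).
  by apply: measurable_funM => //; exact: mX.
apply: (le_trans (exponential_markov _ _ _ P (fun w => l * X T w) x ml)).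
rewrite mgf// -EFinM -expRD lee_fin ler_expR lerD2l lerD//.
  by rewrite (le_trans (ler_norm _))// normrM ler_wpM2l// m_bounded.
rewrite ler_pM2r ?invr_gt0// ler_wpM2l ?sqr_ge0// -lerBlDl.
by rewrite (le_trans (ler_norm _))// s_linear.
Qed.

(** The tilts [b / c] and [- (b / c)] minimize the main part [- b * T * |l| + l ^+ 2 * c * T / 2] of
    the Chernoff exponent. The summand 1 in the exponent absorbs the factor 2 coming from the two
    half-lines, as 2 is at most e. *)
Let two_sided_tail (T b : R) : 0 < T -> 0 <= b ->
  (P [set w | (b <= `|X T w / T|)%R] <=
   (expR (- (b ^+ 2 / (2 * c)) * T + (b / c * m0 + (b / c) ^+ 2 * k / 2 + 1)))%:E)%E.
Proof.
move=> T0 b0; have l0 : 0 <= b / c by rewrite divr_ge0// ltW.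
pose A (l : R) := [set w | b / c * (b * T) <= l * X T w].
have mA l : measurable (A l).
  rewrite (_ : A l = setT `&` (fun w => l * X T w) @^-1` `[b / c * (b * T), +oo[%classic).
    by apply: measurable_funM => //; exact: mX.
  by rewrite setTI; apply/seteqP; split => w /=; rewrite /A/= in_itv/= andbT.
apply: (@le_trans _ _ (P (A (b / c) `|` A (- (b / c))))).
  apply: le_measure; rewrite ?inE//.
  - rewrite (_ : [set w | _] = setT `&`
        (fun w => `|X T w / T|) @^-1` `[b, +oo[%classic).
      by apply: measurableT_comp => //; exact: mXT.
    by rewrite setTI; apply/seteqP; split => w /=; rewrite in_itv/= andbT.
  - exact: measurableU.
  - move=> w /=; rewrite /A/= ler_normr -mulNr !ler_pdivlMr// => /orP[] bX.
      by left; rewrite ler_wpM2l.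
    by right; rewrite mulNr -mulrN ler_wpM2l.
apply: (le_trans (measureU2 P (mA _) (mA _))).
have half l : `|l| = b / c -> (P (A l) <=
    (expR (- (b ^+ 2 / (2 * c)) * T + (b / c * m0 + (b / c) ^+ 2 * k / 2)))%:E)%E.
  move=> lE; apply: (le_trans (half_tail T l (b / c * (b * T)) T0)).
  rewrite lee_fin ler_expR -(real_normK (num_real l)) lE le_eqVlt.
  by apply/orP; left; apply/eqP; field; rewrite gt_eqF.
apply: (le_trans (leeD (half _ _) (half _ _))).
- by rewrite ger0_norm.
- by rewrite normrN ger0_norm.
rewrite -EFinD lee_fin (addrA _ _ 1) [leRHS]expRD; set E := expR _.
have e1 : 2 <= expR (1 : R) by have := expR_ge1Dx (1 : R); lra.
have : 0 <= E * (expR 1 - 2) by rewrite mulr_ge0 ?expR_ge0// subr_ge0.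
by lra.
Qed.

Let J (y : R) := (y ^+ 2 / (2 * c))%:E.

(** The assumption on [r] keeps [C] outside the open interval of radius [b], the square root of
    [2 * c * r], so the two-sided tail at [b] suffices. Its bounded correction [K] vanishes after
    division by [T]. *)
Let upper (C : set R) (r : R) : closed C -> 0 <= r ->
  (forall y, C y -> r <= y ^+ 2 / (2 * c)) ->
  (limf_esup (fun T : R => (T^-1)%:E * lne (P ((fun w => (X T w / T)%R) @^-1` C))) +oo%R
   <= (- r)%:E)%E.
Proof.
move=> cC r0 rC; have c20 : 0 < 2 * c by rewrite mulr_gt0.
pose b := Num.sqrt (2 * c * r).
have bE : b ^+ 2 = 2 * c * r by rewrite sqr_sqrtr// mulr_ge0// ltW.
pose K := b / c * m0 + (b / c) ^+ 2 * k / 2 + 1.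
apply/lee_addgt0Pr => e e0; apply: limf_esup_le; near=> T.
have T0 : 0 < T by near: T; exact: nbhs_pinfty_gt.
apply: (@le_trans _ _ ((- r * T + K) / T)%:E); last first.
  rewrite -EFinD lee_fin mulrDl mulfK ?gt_eqF// lerD2l ler_pdivrMr//.
  rewrite mulrC -ler_pdivrMr//; near: T; apply: nbhs_pinfty_ge.
apply: scaled_lne_le => //.
have rE : r = b ^+ 2 / (2 * c) by rewrite bE mulrC mulKf ?gt_eqF.
rewrite [in leRHS]rE; apply: (le_trans _ (two_sided_tail T b T0 (sqrtr_ge0 _))).
apply: le_measure; rewrite ?inE//.
- apply: measurable_preimage => //; exact: closed_measurable.
- rewrite (_ : [set w | _] = (fun w => X T w / T) @^-1` [set y | b <= `|y|])//.
  apply: measurable_preimage => //.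
  rewrite (_ : [set y | _] = setT `&` (Num.norm : R -> R) @^-1` `[b, +oo[%classic).
    exact: normr_measurable.
  by rewrite setTI; apply/seteqP; split => y /=; rewrite in_itv/= andbT.
- move=> w /= /rC; rewrite ler_pdivlMr// mulrC -bE.
  by rewrite -(real_normK (num_real (_ / _))) ler_pXn2r// nnegrE ?sqrtr_ge0.
Unshelve. all: by end_near. Qed.

(* The tilt [l = y / c] cancels the terms linear in [eta]; [eta] will be
   [delta / c] and [- delta / c]. *)
Let tilted_exponent (T y delta eta : R) : 0 < T -> 0 < delta ->
  `|eta| = delta / c ->
  (2 + delta / c * m0 + (`|y / c| * (delta / c) + (delta / c) ^+ 2 / 2) * k)
    / (delta ^+ 2 / (2 * c)) <= T ->
  (y / c + eta) * m T + (y / c + eta) ^+ 2 * s T / 2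
    - (eta * (y * T) + delta / c * (delta * T))
  <= y / c * m T + (y / c) ^+ 2 * s T / 2 - 2.
Proof.
move=> T0 delta0 etaE; have d0 : 0 < delta ^+ 2 / (2 * c).
  by rewrite divr_gt0 ?exprn_gt0 ?mulr_gt0.
rewrite ler_pdivrMr// => KT.
have em : eta * m T <= delta / c * m0.
  by rewrite (le_trans (ler_norm _))// normrM etaE ler_wpM2l ?m_bounded// divr_ge0 ?ltW.
have es : (y / c * eta + eta ^+ 2 / 2) * (s T - c * T) <=
    (`|y / c| * (delta / c) + (delta / c) ^+ 2 / 2) * k.
  rewrite (le_trans (ler_norm _))// normrM ler_pM ?s_linear//.
  rewrite (le_trans (ler_normD _ _))// normrM etaE lerD2l.
  by rewrite -etaE real_normK ?num_real// ger0_norm// divr_ge0// sqr_ge0.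
rewrite -subr_le0.
(* The square of [eta] costs half of the gain [delta ^+ 2 / c * T]. The other half pays for the
   bounded errors and for the 2, which is how the threshold on [T] arises. *)
have -> : (y / c + eta) * m T + (y / c + eta) ^+ 2 * s T / 2 -
    (eta * (y * T) + delta / c * (delta * T)) -
    (y / c * m T + (y / c) ^+ 2 * s T / 2 - 2) =
    2 + eta * m T + (y / c * eta + eta ^+ 2 / 2) * (s T - c * T)
    + eta ^+ 2 * (c * T) / 2 - delta ^+ 2 / c * T.
  by field; rewrite gt_eqF.
have -> : eta ^+ 2 * (c * T) / 2 = T * (delta ^+ 2 / (2 * c)).
  by rewrite -(real_normK (num_real eta)) etaE; field; rewrite gt_eqF.
have -> : delta ^+ 2 / c * T = 2 * (T * (delta ^+ 2 / (2 * c))).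
  by field; rewrite gt_eqF.
lra.
Qed.

(** A small ball around [y] already has enough mass: at the tilt [y / c] the tails in
    [gaussian_mgf_ball] are a fixed fraction of the total, so the ball carries the rest. *)
Let lower (U : set R) (y : R) : open U -> U y ->
  (- J y <= limf_einf
    (fun T : R => (T^-1)%:E * lne (P ((fun w => (X T w / T)%R) @^-1` U))) +oo%R)%E.
Proof.
move=> oU Uy; apply/lee_subgt0Pr => e e0; apply: limf_einf_ge.
have /nbhs_ballP[d1 d10 dU] : nbhs y U by exact: open_nbhs_nbhs.
(* The radius keeps the ball inside [U] and makes the cost [|y / c| * delta] at most [e / 2]. Beyond
   [K1] the tails are small; beyond the threshold given by [K2] the bounded errors fit into the
   other [e / 2], where the 1 in [K2] accounts for a lost factor 2. *)
pose delta := Num.min d1 (e / 2 / (`|y / c| + 1)).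
have delta0 : 0 < delta.
  by rewrite lt_min d10/= !divr_gt0// ltr_wpDl.
have delta_e : `|y / c| * delta <= e / 2.
  apply: (@le_trans _ _ ((`|y / c| + 1) * delta)).
    by rewrite (ler_wpM2r (ltW delta0))// lerDl.
  by rewrite mulrC -ler_pdivlMr ?ltr_wpDl// ge_min lexx orbT.
pose K1 := (2 + delta / c * m0 +
  (`|y / c| * (delta / c) + (delta / c) ^+ 2 / 2) * k) / (delta ^+ 2 / (2 * c)).
pose K2 := 1 + `|y / c| * m0 + (y / c) ^+ 2 * k / 2.
near=> T.
have T0 : 0 < T by near: T; exact: nbhs_pinfty_gt.
have K1T : K1 <= T by near: T; apply: nbhs_pinfty_ge; exact: num_real.
have K2T : K2 <= e / 2 * T.
  rewrite -ler_pdivrMl ?divr_gt0//; near: T; apply: nbhs_pinfty_ge.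
have muE : `|delta / c| = delta / c by rewrite ger0_norm// divr_ge0 ?ltW.
have mu0 : 0 <= delta / c by rewrite -muE.
pose A := [set w | `|X T w - y * T| < delta * T].
have mA : measurable A.
  rewrite (_ : A = setT `&` (fun w => `|X T w - y * T|) @^-1` `]-oo, delta * T[%classic).
    by apply: measurableT_comp => //; apply: measurable_funB => //; exact: mX.
  by rewrite setTI; apply/seteqP; split => w /=; rewrite in_itv/=.
have AU : (P A <= P ((fun w => (X T w / T)%R) @^-1` U))%E.
  apply: le_measure; rewrite ?inE//.
    by apply: measurable_preimage => //; exact: open_measurable.
  move=> w /= wA; apply: dU; rewrite /ball/= /ball_/= distrC.
  have -> : X T w / T - y = (X T w - y * T) / T by field; rewrite gt_eqF.
  rewrite normrM (gtr0_norm (_ : 0 < T^-1)) ?invr_gt0// ltr_pdivrMr//.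
  by apply: (lt_le_trans wA); rewrite ler_pM2r// ge_min lexx.
have -> : (- J y - e%:E)%E = (- (y ^+ 2 / (2 * c) + e) * T / T)%:E.
  by rewrite mulfK ?gt_eqF// opprD EFinB.
apply: scaled_lne_ge => //; apply: (le_trans _ AU).
have := gaussian_mgf_ball _ _ _ P (X T) (m T) (s T) (y / c) (delta / c)
  (y * T) (delta * T) (mX T T0) (fun l => mgf T l T0) mu0.
rewrite -/A -(@fineK _ (P A)) ?fin_num_measure//.
rewrite -!EFinM -!EFinD !lee_fin; set p := fine _ => main.
pose G := y / c * m T + (y / c) ^+ 2 * s T / 2.
have e1 : 2 <= expR (1 : R) by have := expR_ge1Dx (1 : R); lra.
(* Each tail is at most [expR (G - 2)], hence at most a quarter of the total, so at least half of it
   is left for the ball. *)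
have G2 : 4 * expR (G - 2) <= expR G.
  rewrite -{2}(subrK 2 G) (expRD (G - 2)) mulrC ler_wpM2l ?expR_ge0//.
  have -> : (2 : R) = 1 + 1 by [].
  by rewrite expRD; nra.
have h1 : expR ((y / c + delta / c) * m T + (y / c + delta / c) ^+ 2 * s T / 2 -
    delta / c * (y * T + delta * T)) <= expR (G - 2).
  by rewrite ler_expR mulrDr; exact: tilted_exponent.
have h2 : expR ((y / c - delta / c) * m T + (y / c - delta / c) ^+ 2 * s T / 2 +
    delta / c * (y * T - delta * T)) <= expR (G - 2).
  rewrite ler_expR.
  have -> : delta / c * (y * T - delta * T) =
    - (- (delta / c) * (y * T) + delta / c * (delta * T)) by ring.
  by apply: tilted_exponent => //; rewrite normrN.
have Gp : expR G <= 2 * (expR (y / c * (y * T) + `|y / c| * (delta * T)) * p).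
  by move: main; rewrite -/G; lra.
have {}Gp : expR (G - (y / c * (y * T) + `|y / c| * (delta * T)) - 1) <= p.
  rewrite expRB ler_pdivrMr ?expR_gt0// expRB ler_pdivrMr ?expR_gt0//.
  apply: (le_trans Gp); set E := expR (_ + _).
  have Ep : 0 <= E * p by rewrite mulr_ge0 ?expR_ge0 ?fine_ge0.
  have : 0 <= E * p * (expR 1 - 2) by rewrite mulr_ge0// subr_ge0.
  lra.
apply: le_trans Gp; rewrite ler_expR.
have lm : - (`|y / c| * m0) <= y / c * m T.
  by rewrite lerNl (le_trans (ler_norm _))// normrN normrM ler_wpM2l// m_bounded.
have ls : (y / c) ^+ 2 * (c * T - k) <= (y / c) ^+ 2 * s T.
  rewrite ler_wpM2l ?sqr_ge0// lerBlDr -lerBlDl.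
  by rewrite (le_trans (ler_norm _))// distrC s_linear.
have ed : `|y / c| * (delta * T) <= e / 2 * T.
  by rewrite mulrA ler_wpM2r// ltW.
have yT : y / c * (y * T) = 2 * (y ^+ 2 / (2 * c) * T).
  by field; rewrite gt_eqF.
have yc : (y / c) ^+ 2 * (c * T - k) / 2 =
    y ^+ 2 / (2 * c) * T - (y / c) ^+ 2 * k / 2.
  by field; rewrite gt_eqF.
move: K2T; rewrite /K2 /G yT.
lra.
Unshelve. all: by end_near. Qed.

(** The logarithm of the moment generating function, divided by [T], tends to [c * l ^+ 2 / 2]; the
    rate [y ^+ 2 / (2 * c)] is the Legendre transform of this limit. *)
Theorem gaussian_mgf_ldp :
  large_deviations_principle P (fun T w => X T w / T)
    (fun y => (y ^+ 2 / (2 * c))%:E).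
Proof.
have c20 : 0 < 2 * c by rewrite mulr_gt0.
have J0 y : (0 <= J y)%E by rewrite lee_fin divr_ge0 ?sqr_ge0 ?ltW.
split.
- by move=> T T0; exact: mXT.
- exact: (quadratic_good_rate_function _ _ c20).1.
- move=> U oU; rewrite /ereal_inf oppeK; apply: ge_ereal_sup => _ [_ [y Uy <-] <-].
  exact: lower.
- move=> C cC.
  have I0 : (0 <= ereal_inf [set J y | y in C])%E.
    by apply: le_ereal_inf_tmp => _ [y _ <-].
  have rC r : (r%:E <= ereal_inf [set J y | y in C])%E ->
      forall y, C y -> r <= y ^+ 2 / (2 * c).
    move=> rI y Cy; rewrite -lee_fin (le_trans rI)//.
    by apply: ereal_inf_lbound; exists y.
  have [I|I|I] : [\/ ereal_inf [set J y | y in C] \is a fin_num,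
      ereal_inf [set J y | y in C] = +oo%E |
      ereal_inf [set J y | y in C] = -oo%E].
    by case: ereal_inf => [r| |]; [apply: Or31|apply: Or32|apply: Or33].
  + rewrite -(fineK I); apply: upper => //; first by rewrite fine_ge0.
    by apply: rC; rewrite fineK.
  (* [J] being finite, this is the case of an empty [C]: [upper] applies with arbitrarily large
     rates. The absolute value provides the nonnegative rate that [upper] asks for. *)
  + rewrite I/= leeNy_eq; apply/eqP/eq_ninfty => r.
    apply: (@le_trans _ _ (- `|r|)%:E); last first.
      by rewrite lee_fin lerNl ler_normr lexx orbT.
    by apply: upper => //; apply: rC; rewrite I leey.
  + by rewrite I leeNy_eq in I0.
Qed.

End gaussian_ldp.

(** * Moment generating function of a Brownian sum *)

(** The Radon-Nikodym derivative of [normal_prob] and [normal_pdf] have the same integral over every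
    measurable set, so they agree almost everywhere and may be exchanged under the integral. *)
Lemma ge0_integral_normal_prob (R : realType) (m sigma : R) (f : R -> \bar R) :
  measurable_fun setT f -> (forall x, (0 <= f x)%E) ->
  (\int[normal_prob m sigma]_x f x =
   \int[lebesgue_measure]_x (f x * (normal_pdf m sigma x)%:E))%E.
Proof.
move=> mf f0.
have dom := @normal_prob_dominates R m sigma.
have mpdf : measurable_fun [set: R] (fun x => (normal_pdf m sigma x)%:E).
  by apply/measurable_EFinP; exact: measurable_normal_pdf.
have fi := Radon_Nikodym_SigmaFinite.f_integrable dom.
rewrite -(Radon_Nikodym_SigmaFinite.change_of_variables dom f0 measurableT mf).
apply: ae_eq_integral => //.
- apply: emeasurable_funM => //; exact: measurable_int fi.
- exact: emeasurable_funM.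
- apply: ae_eqe_mul2l; apply: integral_ae_eq => //.
  by move=> E _ mE; rewrite -Radon_Nikodym_SigmaFinite.f_integral.
Qed.

Lemma normal_mgf (R : realType) (m sigma l : R) : sigma != 0 ->
  (\int[normal_prob m sigma]_x (expR (l * x))%:E =
   (expR (l * m + l ^+ 2 * sigma ^+ 2 / 2))%:E)%E.
Proof.
move=> s0.
rewrite ge0_integral_normal_prob; last 2 first.
- by apply/measurable_EFinP; apply: measurableT_comp.
- by move=> x; rewrite lee_fin expR_ge0.
(* Completing the square turns the exponentially weighted density into a constant times the density
   with mean [m + l * sigma ^+ 2]. *)
transitivity (\int[lebesgue_measure]_x
   ((expR (l * m + l ^+ 2 * sigma ^+ 2 / 2))%:E *
    (normal_pdf (m + l * sigma ^+ 2) sigma x)%:E))%E.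
  apply: eq_integral => x _; rewrite -!EFinM; congr EFin.
  rewrite !normal_pdfE// mulrCA [RHS]mulrCA; congr (_ * _).
  rewrite /normal_fun -!expRD; congr expR.
  by field.
rewrite ge0_integralZl//.
- by rewrite integral_normal_pdf mule1.
- by apply/measurable_EFinP; exact: measurable_normal_pdf.
- by move=> x _; rewrite lee_fin normal_pdf_ge0.
Qed.

(** Independence says that the joint law agrees with the product of the marginals on rectangles,
    hence on all measurable sets; Tonelli then separates the integrals. *)
Lemma ge0_integral_independentM (d : measure_display) (Omega : measurableType d)
    (R : realType) (P : probability Omega R) (U V : Omega -> R)
    (f g : R -> \bar R) :
  measurable_fun setT U -> measurable_fun setT V ->
  (forall A B, measurable A -> measurable B ->
    P ((U @^-1` A) `&` (V @^-1` B)) = (P (U @^-1` A) * P (V @^-1` B))%E) ->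
  measurable_fun setT f -> measurable_fun setT g ->
  (forall x, (0 <= f x)%E) -> (forall x, (0 <= g x)%E) ->
  (\int[P]_w (f (U w) * g (V w)) =
   (\int[P]_w f (U w)) * (\int[P]_w g (V w)))%E.
Proof.
move=> mU mV UV mf mg f0 g0.
pose mfU : {mfun Omega >-> R} := mfun_Sub (mem_set mU).
pose mfV : {mfun Omega >-> R} := mfun_Sub (mem_set mV).
have mUV : measurable_fun setT (fun w => (U w, V w)) by exact: measurable_fun_pair.
pose mfUV : {mfun Omega >-> (R * R)%type} := mfun_Sub (mem_set mUV).
have mh : measurable_fun setT (fun z : R * R => (f z.1 * g z.2)%E).
  by apply: emeasurable_funM; apply: measurableT_comp.
have h0 z : (0 <= f z.1 * g z.2)%E by rewrite mule_ge0.
transitivity (\int[distribution P mfUV]_z (f z.1 * g z.2))%E.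
  by rewrite ge0_integral_distribution.
have UVE (A : set (R * R)) : measurable A ->
    (distribution P mfU \x distribution P mfV)%E A = distribution P mfUV A.
  by apply: product_measure_unique => B C mB mC; exact: UV.
transitivity (\int[distribution P mfU \x distribution P mfV]_z (f z.1 * g z.2))%E.
  by apply: eq_measure_integral => A mA _; apply/esym; exact: UVE.
rewrite fubini_tonelli1//= /fubini_F/=.
under eq_integral do rewrite ge0_integralZl//.
rewrite ge0_integralZr//; last by apply: integral_ge0.
by rewrite !ge0_integral_distribution.
Qed.

Section sub_sigma_algebra_measurability.
Context (d : measure_display) (Omega : measurableType d) (R : realType).
Implicit Types (G : set (set Omega)) (U V : Omega -> R).

(** A sigma-algebra is the one it generates. This makes the closure properties of measurable
    functions available for a member of the filtration, which is only a collection of sets. *)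
Lemma measurable_fun_sub_sigma_algebraP G U : sigma_algebra setT G ->
  measurable_fun [set: g_sigma_algebraType G] U <->
  forall B : set R, measurable B -> G (U @^-1` B).
Proof.
move=> sG; have GE := measurable_g_measurableTypeE sG.
split=> [mU B mB|GU _ B mB].
- by rewrite -GE -[X in measurable X]setTI; exact: mU.
- by rewrite setTI GE; exact: GU.
Qed.

Lemma sub_sigma_algebra_addM G U V V' (c : R) : sigma_algebra setT G ->
  (forall B : set R, measurable B -> G (U @^-1` B)) ->
  (forall B : set R, measurable B -> G (V @^-1` B)) ->
  (forall B : set R, measurable B -> G (V' @^-1` B)) ->
  forall B : set R, measurable B ->
    G ((fun w => U w + c * (V w - V' w)) @^-1` B).
Proof.
move=> sG /measurable_fun_sub_sigma_algebraP-/(_ sG) mU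
  /measurable_fun_sub_sigma_algebraP-/(_ sG) mV
  /measurable_fun_sub_sigma_algebraP-/(_ sG) mV'.
apply/measurable_fun_sub_sigma_algebraP => //.
apply: measurable_funD => //; apply: measurable_funM => //.
exact: measurable_funB.
Qed.

End sub_sigma_algebra_measurability.

Section brownian_mgf.
Context (d : measure_display) (Omega : measurableType d) (R : realType)
  (P : probability Omega R) (F : R -> set (set Omega)) (W : R -> Omega -> R).
Hypothesis hF : complete_filtration P F.
Hypothesis hW : brownian_motion P F W.

Lemma adapted_measurable_fun (X : R -> Omega -> R) (t : R) :
  adapted F X -> 0 <= t -> measurable_fun setT (X t).
Proof.
move=> aX t0 _ B mB; rewrite setTI.
by apply: (filtration_measurable hF t0); exact: aX.
Qed.

Lemma brownian_increment_mgf (s t l : R) : 0 <= s -> s < t ->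
  (\int[P]_w (expR (l * (W t w - W s w)))%:E =
   (expR (l ^+ 2 * (t - s) / 2))%:E)%E.
Proof.
move=> s0 st; have t0 : 0 <= t by rewrite (le_trans s0)// ltW.
have mW (r : R) : 0 <= r -> measurable_fun setT (W r).
  exact/adapted_measurable_fun/(brownian_adapted hW).
have mV : measurable_fun setT (fun w => W t w - W s w).
  by apply: measurable_funB; exact: mW.
pose V : {mfun Omega >-> R} := mfun_Sub (mem_set mV).
transitivity (\int[distribution P V]_x (expR (l * x))%:E)%E.
  rewrite ge0_integral_distribution//.
  by apply/measurable_EFinP; apply: measurableT_comp.
(* [normal_prob] is a measure on [measurableTypeR R], whose structure does not
   unify with the canonical one of [R]; it is transported along the identity. *)
have mid : measurable_fun setT (id : measurableTypeR R -> R) by [].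
pose I : {mfun measurableTypeR R >-> R} :=
  @mfun_Sub _ _ (measurableTypeR R) R id (mem_set mid).
pose N := normal_prob (0 : R) (Num.sqrt (t - s)).
transitivity (\int[distribution N I]_x (expR (l * x))%:E)%E.
  apply: eq_measure_integral => B mB _.
  exact: (brownian_gaussian hW s0 st mB).
rewrite ge0_integral_distribution//=; last first.
  by apply/measurable_EFinP; apply: measurableT_comp.
rewrite normal_mgf; last by rewrite gt_eqF// sqrtr_gt0 subr_gt0.
by rewrite mulr0 add0r sqr_sqrtr// subr_ge0 ltW.
Qed.

Context (t c : nat -> R).
Hypothesis t_ge0 : 0 <= t 0%N.
Hypothesis t_increasing : forall n, t n < t n.+1.

Let t_nonneg n : 0 <= t n.
Proof. by elim: n => // n /le_trans; apply; exact: ltW. Qed.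

Let S n w := \sum_(i < n) c i * (W (t i.+1) w - W (t i) w).

(** Being measurable at time [t n] makes the partial sum independent of the next increment, which
    drives the induction in [brownian_sum_mgf]. *)
Let S_adapted n (B : set R) : measurable B -> F (t n) (S n @^-1` B).
Proof.
elim: n B => [|n IHn] B mB.
  have sF := filtration_sigma_algebra hF (t_nonneg 0).
  apply/(measurable_fun_sub_sigma_algebraP _ _ _ (F (t 0%N)) (S 0) sF).1 => //.
  rewrite (_ : S 0 = cst 0); first exact: measurable_cst.
  by apply/funext => w; rewrite /S big_ord0.
have sF := filtration_sigma_algebra hF (t_nonneg n.+1).
have le := filtration_nondecreasing hF (t_nonneg n) (ltW (t_increasing n)).
rewrite (_ : S n.+1 = fun w => S n w + c n * (W (t n.+1) w - W (t n) w)).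
  apply: sub_sigma_algebra_addM => // A mA.
  - exact/le/IHn.
  - exact: (brownian_adapted hW).
  - by apply: le; exact: (brownian_adapted hW).
by apply/funext => w; rewrite /S big_ord_recr.
Qed.

Lemma brownian_sum_mgf n :
  (\int[P]_w (expR (\sum_(i < n) c i * (W (t i.+1) w - W (t i) w)))%:E =
   (expR (\sum_(i < n) c i ^+ 2 * (t i.+1 - t i) / 2))%:E)%E.
Proof.
elim: n => [|n IHn].
  under eq_integral do rewrite big_ord0 expR0.
  by rewrite big_ord0 expR0 integral_cst// mul1e; exact: probability_setT.
have mW (r : R) : 0 <= r -> measurable_fun setT (W r).
  exact/adapted_measurable_fun/(brownian_adapted hW).
have mS : measurable_fun setT (S n).
  move=> _ B mB; rewrite setTI.
  by apply: (filtration_measurable hF (t_nonneg n)); exact: S_adapted.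
have mV : measurable_fun setT (fun w => W (t n.+1) w - W (t n) w).
  by apply: measurable_funB; exact: mW.
transitivity (\int[P]_w ((expR (S n w))%:E *
    (expR (c n * (W (t n.+1) w - W (t n) w)))%:E))%E.
  by apply: eq_integral => w _; rewrite big_ord_recr/= expRD EFinM.
rewrite (@ge0_integral_independentM _ _ _ P (S n)
  (fun w => W (t n.+1) w - W (t n) w) (fun x => (expR x)%:E)
  (fun x => (expR (c n * x))%:E))//.
- rewrite IHn brownian_increment_mgf// -EFinM -expRD.
  by rewrite big_ord_recr.
- move=> A B mA mB.
  exact: (brownian_independent hW (t_nonneg n) (t_increasing n) (S_adapted n A mA) mB).
- by apply/measurable_EFinP.
- by apply/measurable_EFinP; apply: measurableT_comp.
Qed.

End brownian_mgf.

(** * Discretization of the oscillator *)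

(** Heine-Cantor, through the near-covering form of compactness. Around [z] half of the continuity
    radius goes to [s] and the other half to the distance from [s] to [s']. *)
Lemma segment_uniformly_continuous (R : realType) (f : R -> R) (a b e : R) :
  {within `[a, b], continuous f} -> 0 < e ->
  exists2 delta, 0 < delta & forall s s', s \in `[a, b] -> s' \in `[a, b] ->
    `|s - s'| < delta -> `|f s - f s'| <= e.
Proof.
move=> cf e0.
have /compact_near_coveringP cov := @segment_compact R a b.
have h : \forall delta \near 0^'+, `[a, b]%classic `<=` [set s | s \in `[a, b] ->
    forall s', s' \in `[a, b] -> `|s - s'| < delta -> `|f s - f s'| <= e].
  apply: cov => z zab.
  have : \forall s \near within `[a, b] (nbhs z), `|f z - f s| <= e / 2.
    have := cf z; rewrite /continuous_at nbhs_subspace_in//.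
    by move/cvgr_dist_le; apply; rewrite divr_gt0.
  rewrite near_withinE => /nbhs_ballP[r /= r0 zr].
  exists (ball z (r / 2), [set delta | delta < r / 2]) => /=.
    split; first by apply: nbhsx_ballx; rewrite divr_gt0.
    by apply: nbhs_right_lt; rewrite divr_gt0.
  move=> [s delta] [/= zs deltar] sab s' s'ab ss'.
  have fs : `|f z - f s| <= e / 2.
    apply: zr => //; apply: lt_trans zs _; lra.
  have fs' : `|f z - f s'| <= e / 2.
    apply: zr => //; rewrite /ball/= (le_lt_trans (ler_distD s _ _))//.
    by rewrite (splitr r) ltrD// (lt_trans ss').
  by have := ler_distD (f z) (f s) (f s'); rewrite (distrC (f s) (f z)); lra.
near (0 : R)^'+ => delta; exists delta; first by near: delta; exact: nbhs_right_gt.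
near: delta; apply: filterS h => delta h s s' sab s'ab.
by apply: h => //; exact: sab.
Unshelve. all: by end_near. Qed.

(** Serves to compare a total increment with a Riemann or Ito sum, cell by cell. *)
Lemma telescope_approx (R : realDomainType) (K a : nat -> R) (b : R) (n : nat) :
  (forall i, (i < n)%N -> `|K i.+1 - K i - a i| <= b) ->
  `|K n - K 0 - \sum_(i < n) a i| <= b *+ n.
Proof.
elim: n => [|n IHn] Kab; first by rewrite big_ord0 subrr subr0 normr0.
rewrite big_ord_recr/= mulrSr.
have := IHn (fun i ni => Kab i (ltnW ni)); have := Kab n (ltnSn n).
have := ler_normD (K n - K 0 - \sum_(i < n) a i) (K n.+1 - K n - a n).
have -> : K n - K 0 - \sum_(i < n) a i + (K n.+1 - K n - a n) =
  K n.+1 - K 0 - (\sum_(i < n) a i + a n) by ring.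
lra.
Qed.

Lemma mean_value_approx (R : realType) (f df : R -> R) (a b k e : R) :
  a < b -> (forall s, s \in `]a, b[ -> is_derive s 1 f (df s)) ->
  {within `[a, b], continuous f} ->
  (forall s, s \in `[a, b] -> `|df s - k| <= e) ->
  `|f b - f a - k * (b - a)| <= e * (b - a).
Proof.
move=> ab fdf cf dfk; have [s sab ->] := MVT ab fdf cf.
rewrite -mulrBl normrM (gtr0_norm (_ : 0 < b - a)) ?subr_gt0//.
rewrite ler_pM2r ?subr_gt0//; apply: dfk.
exact: subset_itv_oo_cc.
Qed.

Lemma integral_equation_derive (R : realType) (f g : R -> R) (a s : R) :
  {within `[0, +oo[, continuous g} ->
  (forall t, 0 <= t -> f t = a + \int[lebesgue_measure]_(r in `[0, t]) g r) ->
  0 < s -> is_derive s 1 f (g s).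
Proof.
move=> cg fE s0.
have cgs : {for s, continuous g}.
  by move/continuous_within_itvcyP: cg => [+ _]; apply; rewrite in_itv/= s0.
(* The interval is extended to [s + 1] so that [s] lies in its interior, as the fundamental theorem
   of calculus requires. *)
have ig : lebesgue_measure.-integrable `[0, s + 1] (EFin \o g).
  apply: continuous_compact_integrable; first exact: segment_compact.
  apply: continuous_subspaceW cg => t /=; rewrite !in_itv/= andbT.
  by case/andP.
have ss1 : s < s + 1 by rewrite ltrDl.
have [dG GE] := continuous_FTC1_closed ss1 ig s0 cgs.
have isG : is_derive s 1 (fun t => \int[lebesgue_measure]_(r in `[0, t]) g r) (g s).
  by rewrite -GE derive1E; apply: DeriveDef.
apply: (@near_eq_is_derive _ _ _
    (cst a + (fun t => \int[lebesgue_measure]_(r in `[0, t]) g r))).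
  near=> t; rewrite fE//; near: t.
  by apply: filterS (lt_nbhsr s0) => t /ltW.
by apply: is_derive_eq; rewrite add0r.
Unshelve. all: by end_near. Qed.

Definition mesh (R : realType) (T : R) (n i : nat) : R := i%:R * (T / n%:R).

Section oscillator_path.
Context (R : realType) (T : R) (n : nat).
Hypothesis T_gt0 : 0 < T.
Hypothesis n_gt0 : (0 < n)%N.

Local Notation t := (mesh R T n).

Let n0 : 0 < n%:R :> R. Proof. by rewrite ltr0n. Qed.

Let mesh_gt0 : 0 < T / n%:R. Proof. exact: divr_gt0. Qed.

Let mesh_step i : t i.+1 - t i = T / n%:R.
Proof. by rewrite /mesh -mulrBl -natrB// subSnn mul1r. Qed.

Let mesh_lt i : t i < t i.+1.
Proof. by rewrite -subr_gt0 mesh_step. Qed.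

Let mesh_ge0 i : 0 <= t i.
Proof. by rewrite mulr_ge0// ltW. Qed.

Let mesh_le i : (i <= n)%N -> t i <= T.
Proof.
by move=> ni; rewrite /mesh mulrA ler_pdivrMr// mulrC ler_pM2l// ler_nat.
Qed.

Let mesh0 : t 0 = 0. Proof. by rewrite /mesh mul0r. Qed.

Let meshn : t n = T. Proof. by rewrite /mesh mulrC divfK// gt_eqF. Qed.

Let mesh_sub i (s : R) : (i < n)%N -> s \in `[t i, t i.+1] -> s \in `[0, T].
Proof.
move=> ni; rewrite !in_itv/= => /andP[si iS].
by rewrite (le_trans (mesh_ge0 i) si) (le_trans iS (mesh_le i.+1 ni)).
Qed.

Let is_derive_cosT (s : R) : is_derive s 1 (fun r => cos (T - r)) (sin (T - s)).
Proof.
have h : is_derive s 1 (cst T - id : R -> R) (- 1).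
  by apply: is_derive_eq; rewrite sub0r.
have := @is_derive1_comp _ (@cos R) (fun r => T - r) s _ _ (is_derive_cos (T - s)) h.
by move=> /is_derive_eq; apply; rewrite mulrN1 opprK.
Qed.

Let is_derive_sinT (s : R) : is_derive s 1 (fun r => sin (T - r)) (- cos (T - s)).
Proof.
have h : is_derive s 1 (cst T - id : R -> R) (- 1).
  by apply: is_derive_eq; rewrite sub0r.
have := @is_derive1_comp _ (@sin R) (fun r => T - r) s _ _ (is_derive_sin (T - s)) h.
by move=> /is_derive_eq; apply; rewrite mulrN1.
Qed.

Lemma sin_square_riemann_sum (e : R) :
  (forall s s' : R, s \in `[0, T] -> s' \in `[0, T] -> `|s - s'| <= T / n%:R ->
    `|sin (T - s) ^+ 2 - sin (T - s') ^+ 2| <= e) ->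
  `|(T - sin T * cos T) / 2 -
    \sum_(i < n) sin (T - t i) ^+ 2 * (t i.+1 - t i)| <= e * T.
Proof.
move=> se.
(* A primitive of the squared sine, because 1 minus the squared cosine plus the squared sine is
   twice the squared sine. *)
pose Q := fun s => 2^-1 *: (s + sin (T - s) * cos (T - s)).
have dQ (s : R) : is_derive s 1 Q (sin (T - s) ^+ 2).
  have := is_deriveZ 2^-1 (is_deriveD (is_derive_id s 1)
    (is_deriveM (is_derive_sinT s) (is_derive_cosT s))).
  move=> /is_derive_eq; apply.
  have := cos2Dsin2 (T - s). by rewrite /GRing.scale/=; nra.
have -> : (T - sin T * cos T) / 2 = Q (t n) - Q (t 0).
  rewrite meshn mesh0 /Q subrr subr0 sin0 mul0r addr0 add0r -scalerBr.
  by rewrite /GRing.scale/= mulrC.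
rewrite (_ : e * T = (e * (T / n%:R)) *+ n); last first.
  by rewrite -mulr_natr -mulrA divfK// gt_eqF.
apply: (@telescope_approx _ (fun i => Q (t i))
  (fun i => sin (T - t i) ^+ 2 * (t i.+1 - t i))).
move=> i ni; rewrite -(mesh_step i).
apply: (mean_value_approx _ _ (fun s => sin (T - s) ^+ 2)) => //.
- apply: derivable_within_continuous => s _; exact: ex_derive.
- move=> s si; apply: se.
  + exact: mesh_sub ni si.
  + by apply: (mesh_sub _ _ ni); rewrite in_itv/= lexx ltW.
  + rewrite -(mesh_step i) ger0_norm ?subr_ge0 ?lerD2r;
    by rewrite in_itv/= in si; case/andP: si.
Qed.

(** Variation of constants for a single path. The combination [K] below, a rotation of the pair by
    the remaining time [T - s], passes from [x0 * cos T + y0 * sin T] at 0 to [x T] at [T], and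
    formally its differential is [alpha * sin (T - s)] times that of [w]. Each of the [n] cells
    contributes an error of at most [alpha * e * (T / n)]. *)
Lemma oscillator_path_approx (alpha x0 y0 e : R) (x y w : R -> R) :
  0 < alpha -> w 0 = 0 ->
  {within `[0, +oo[, continuous x} -> {within `[0, +oo[, continuous y} ->
  {within `[0, +oo[, continuous w} ->
  (forall r : R, 0 <= r -> x r = x0 + \int[lebesgue_measure]_(s in `[0, r]) y s) ->
  (forall r : R, 0 <= r ->
    y r = y0 - \int[lebesgue_measure]_(s in `[0, r]) x s + alpha * w r) ->
  (forall s s' : R, s \in `[0, T] -> s' \in `[0, T] -> `|s - s'| <= T / n%:R ->
    `|w s - w s'| <= e) ->
  `|x T - (x0 * cos T + y0 * sin T)
    - alpha * \sum_(i < n) sin (T - t i) * (w (t i.+1) - w (t i))|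
  <= alpha * e * T.
Proof.
move=> alpha0 w0 cx cy cw xE yE we.
pose v (s : R) := y s - alpha * w s.
have dx (s : R) : 0 < s -> is_derive s 1 x (y s).
  exact: (integral_equation_derive _ x y x0 s cy xE).
have dv (s : R) : 0 < s -> is_derive s 1 v (- x s).
  move=> s0.
  (* The sign is changed because [integral_equation_derive] expects the integral with a plus
     sign. *)
  have : is_derive s 1 (fun r => - v r) (x s).
    apply: (integral_equation_derive _ _ x (- y0)) => // r r0.
    by rewrite /v yE//; ring.
  move/is_deriveN => /is_derive_eq-/(_ _ erefl).
  by rewrite (_ : - _ = v)//; apply/funext => r; rewrite /= opprK.
have cS (A : set R) : {within A, continuous (fun s => sin (T - s))}.
  apply: continuous_subspaceT => s.
  by apply/differentiable_continuous/derivable1_diffP; exact: ex_derive.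
have cC (A : set R) : {within A, continuous (fun s => cos (T - s))}.
  apply: continuous_subspaceT => s.
  by apply/differentiable_continuous/derivable1_diffP; exact: ex_derive.
have cst_v : {within `[0, +oo[, continuous v}.
  by move=> s; apply: cvgB; [exact: cy|apply: cvgMr; exact: cw].
(* [v] solves an equation without noise, so the derivative of [H k] below is
   [alpha * (w - k) * cos (T - s)], small when [k] is a nearby value of [w]. *)
pose K (s : R) := x s * cos (T - s) + y s * sin (T - s).
have -> : x T - (x0 * cos T + y0 * sin T) = K (t n) - K (t 0%N).
  rewrite meshn mesh0 /K subrr subr0 sin0 cos0 mulr0 mulr1 addr0.
  by rewrite (xE 0)// (yE 0)// set_itv1 !Rintegral_set1 w0 mulr0 !addr0 subr0.
rewrite mulr_sumr (_ : alpha * e * T = (alpha * e * (T / n%:R)) *+ n); last first.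
  by rewrite -mulr_natr -(mulrA (alpha * e)) divfK// gt_eqF.
apply: (@telescope_approx _ (fun i => K (t i))
  (fun i => alpha * (sin (T - t i) * (w (t i.+1) - w (t i))))).
move=> i ni; rewrite -(mesh_step i).
pose H k s := x s * cos (T - s) + (v s + alpha * k) * sin (T - s).
(* Since [H k s] is [K s + alpha * (k - w s) * sin (T - s)], taking for [k] the value of [w] at the
   right endpoint gives [K] there, and at the left endpoint [K] plus exactly the Ito term. The
   increment of [H] is thus the local error, compared with slope 0. *)
have -> : K (t i.+1) - K (t i) - alpha * (sin (T - t i) * (w (t i.+1) - w (t i))) =
    H (w (t i.+1)) (t i.+1) - H (w (t i.+1)) (t i) - 0 * (t i.+1 - t i).
  by rewrite /H /K /v; ring.
apply: (mean_value_approx _ _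
  (fun s => alpha * (w s - w (t i.+1)) * cos (T - s))) => //.
- move=> s; rewrite in_itv/= => /andP[/(le_lt_trans (mesh_ge0 i)) s0 _].
  have := is_deriveD (is_deriveM (dx s s0) (is_derive_cosT s))
    (is_deriveM (is_deriveD (dv s s0) (is_derive_cst (alpha * w (t i.+1)) s 1))
      (is_derive_sinT s)).
  move=> /is_derive_eq; apply.
  by rewrite /GRing.scale/= !fctE /v /=; ring.
- have cH : {within `[0, +oo[, continuous (H (w (t i.+1)))}.
    move=> s; apply: cvgD; first by apply: cvgM; [exact: cx|exact: cC].
    apply: cvgM; last exact: cS.
    by apply: cvgD; [exact: cst_v|exact: cvg_cst].
  apply: continuous_subspaceW cH => s /=.
  by rewrite !in_itv/= andbT => /andP[+ _]; exact: le_trans.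
- move=> s si; rewrite subr0 normrM (le_trans (ler_piMr _ (cos_max _)))//.
  rewrite normrM gtr0_norm// ler_pM2l//; apply: we.
  + exact: mesh_sub ni si.
  + by apply: (mesh_sub _ _ ni); rewrite in_itv/= lexx ltW.
  + rewrite distrC -(mesh_step i) ger0_norm ?subr_ge0 ?lerD2l ?lerN2;
    by rewrite in_itv/= in si; case/andP: si.
Qed.
End oscillator_path.

(** * Passage to the limit *)

Section second_moment_convergence.
Context (d : measure_display) (Omega : measurableType d) (R : realType)
  (P : probability Omega R) (U : nat -> Omega -> R) (V : Omega -> R)
  (u v : nat -> R) (a b : R).
Hypothesis mU : forall n, measurable_fun setT (U n).
Hypothesis mV : measurable_fun setT V.
Hypothesis U0 : forall n w, 0 <= U n w.
Hypothesis V0 : forall w, 0 <= V w.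
Hypothesis UV : {ae P, forall w, U ^~ w @ \oo --> V w}.
Hypothesis uE : forall n, (\int[P]_w (U n w)%:E = (u n)%:E)%E.
Hypothesis vE : forall n, (\int[P]_w (U n w ^+ 2)%:E = (v n)%:E)%E.
Hypothesis ua : u @ \oo --> a.
Hypothesis vb : v @ \oo --> b.

Let truncated (k : R) (f : Omega -> R) w := Num.min (f w) k.

Let m_truncated (k : R) (f : Omega -> R) : measurable_fun setT f ->
  measurable_fun setT (fun w => (truncated k f w)%:E).
Proof.
move=> mf; apply/measurable_EFinP.
exact: (measurable_minr mf (measurable_cst k)).
Qed.

Let truncated_fin (k : R) (f : Omega -> R) :
  0 < k -> measurable_fun setT f -> (forall w, 0 <= f w) ->
  (\int[P]_w (truncated k f w)%:E)%E \is a fin_num.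
Proof.
move=> k0 mf f0; rewrite ge0_fin_numE; last first.
  by apply: integral_ge0 => w _; rewrite lee_fin le_min f0 ltW.
apply: (@le_lt_trans _ _ (\int[P]_w (cst k%:E w))%E); last first.
  by rewrite integral_cst//= probability_setT mule1 ltry.
apply: ge0_le_integral => //.
- by move=> w _; rewrite lee_fin le_min f0 ltW.
- exact: m_truncated.
- by move=> w _; rewrite lee_fin ge_min lexx orbT.
Qed.

Let truncated_cvg (k : R) : 0 < k ->
  (\int[P]_w (truncated k (U n) w)%:E)%E @[n --> \oo] -->
  (\int[P]_w (truncated k V w)%:E)%E.
Proof.
move=> k0; have := @dominated_convergence _ _ _ P setT measurableT
  (fun n w => (truncated k (U n) w)%:E) (fun w => (truncated k V w)%:E) (cst k%:E).
case => //.
- by move=> n; exact: m_truncated.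
- exact: m_truncated.
- case: UV => N [mN N0 UN]; exists N; split => // w /= nUV; apply: UN => /= h.
  apply: nUV => _; apply: cvg_EFin; first by near=> n.
  have cm : {for V w, continuous (fun x : R => Num.min x k)}.
    by apply: (@continuous_min R R id (cst k)); [exact: cvg_id|exact: cvg_cst].
  exact: (cvg_comp _ _ h cm).
- exact: finite_measure_integrable_cst.
- apply: aeW => w n _; rewrite lee_fin ger0_norm ?ge_min ?lexx ?orbT//.
  by rewrite le_min U0 ltW.
Unshelve. all: by end_near. Qed.

(* The lower bound comes from [u <= min u k + u ^ 2 / k]. *)
Let truncated_bounds (k : R) : 0 < k ->
  a - b / k <= fine (\int[P]_w (truncated k V w)%:E)%E <= a.
Proof.
move=> k0; have := truncated_cvg k k0.
rewrite -[X in _ --> X -> _](fineK (truncated_fin k V k0 mV V0)) => /fine_cvg cI.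
have tf n := truncated_fin k (U n) k0 (mU n) (U0 n).
apply/andP; split.
  have c1 : (fun n => u n - v n / k) @ \oo --> a - b / k.
    by apply: cvgB => //; apply: cvgMl.
  apply: (ler_cvg_to c1 cI); near=> n.
  rewrite lerBlDr -lee_fin EFinD fineK// -uE mulrC EFinM -vE.
  have mU2 : measurable_fun setT (fun w => (U n w ^+ 2)%:E).
    by apply/measurable_EFinP; exact: measurable_funX.
  have U20 w : setT w -> (0 <= (U n w ^+ 2)%:E)%E by rewrite lee_fin sqr_ge0.
  have mT := m_truncated k (U n) (mU n).
  have T0 w : setT w -> (0 <= (truncated k (U n) w)%:E)%E.
    by rewrite lee_fin le_min U0 ltW.
  have mkU : measurable_fun setT (fun w => (k^-1%:E * (U n w ^+ 2)%:E)%E).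
    exact: emeasurable_funM.
  have kU0 w : setT w -> (0 <= k^-1%:E * (U n w ^+ 2)%:E)%E.
    by move=> _; rewrite -EFinM lee_fin mulr_ge0 ?sqr_ge0// invr_ge0 ltW.
  rewrite -ge0_integralZl//; last by rewrite lee_fin invr_ge0 ltW.
  rewrite -ge0_integralD//.
  apply: ge0_le_integral => //.
  - by move=> w _; rewrite lee_fin.
  - by apply/measurable_EFinP.
  - exact: emeasurable_funD.
  - move=> w _; rewrite -EFinM -EFinD lee_fin /truncated.
    have [Uk|kU] := leP (U n w) k.
      by rewrite lerDl mulr_ge0 ?sqr_ge0// invr_ge0 ltW.
    apply: (@le_trans _ _ (k^-1 * U n w ^+ 2)); last by rewrite lerDr ltW.
    by rewrite ler_pdivlMl// expr2 ler_wpM2r// ltW.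
apply: (ler_cvg_to cI ua); near=> n.
rewrite -lee_fin fineK// -uE; apply: ge0_le_integral => //.
- by move=> w _; rewrite lee_fin le_min U0 ltW.
- exact: m_truncated.
- by apply/measurable_EFinP.
- by move=> w _; rewrite lee_fin ge_min lexx.
Unshelve. all: by end_near. Qed.

(** Convergent second moments supply the uniform integrability: truncating at level [k] loses at
    most [b / k] in the limit. Letting [k] grow, monotone convergence restores the integral of [V].
    The levels [k.+1] avoid truncation at 0. *)
Lemma second_moment_integral_cvg : (\int[P]_w (V w)%:E)%E = a%:E.
Proof.
have c1 : (\int[P]_w (truncated k.+1%:R V w)%:E)%E @[k --> \oo] -->
    (\int[P]_w (V w)%:E)%E.
  rewrite (eq_integral (fun w => limn (fun k => (truncated k.+1%:R V w)%:E))).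
    apply: cvg_monotone_convergence => //.
    - by move=> n; exact: m_truncated.
    - by move=> n w _; rewrite lee_fin le_min V0 ler0n.
    - move=> w _ i j ij; rewrite lee_fin le_min !ge_min lexx/=.
      by rewrite ler_nat ltnS ij orbT.
  move=> w _; apply/esym/cvg_lim => //; apply: cvg_near_cst.
  near=> k; congr EFin; apply/min_idPl.
  rewrite (@le_trans _ _ k%:R) ?ler_nat//; near: k; exact: nbhs_infty_ger.
have c2 : (\int[P]_w (truncated k.+1%:R V w)%:E)%E @[k --> \oo] --> a%:E.
  apply: cvg_EFin.
    by near=> k; exact: truncated_fin.
  apply: (@squeeze_cvgr _ _ _ _ (fun k => a - b / k.+1%:R) (cst a)).
  - by near=> k; exact: truncated_bounds.
  - rewrite -[X in _ --> X]subr0; apply: cvgB; first exact: cvg_cst.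
    rewrite -[X in _ --> X](mulr0 b); apply: cvgM; first exact: cvg_cst.
    exact: cvg_harmonic.
  - exact: cvg_cst.
exact: cvg_unique c1 c2.
Unshelve. all: by end_near. Qed.

End second_moment_convergence.

Lemma mesh_step_eventually_small (R : realType) (T delta : R) :
  0 < T -> 0 < delta -> \forall n \near \oo, T / n.+1%:R < delta.
Proof.
move=> T0 d0; near=> n.
rewrite ltr_pdivrMr// mulrC -ltr_pdivrMr//.
apply: (@le_lt_trans _ _ n%:R); last by rewrite ltr_nat.
by near: n; exact: nbhs_infty_ger.
Unshelve. all: by end_near. Qed.

Lemma sin_square_riemann_sum_cvg (R : realType) (T : R) : 0 < T ->
  (fun n => \sum_(i < n.+1) sin (T - mesh R T n.+1 i) ^+ 2 *
    (mesh R T n.+1 i.+1 - mesh R T n.+1 i)) @ \oo -->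
  (T - sin T * cos T) / 2.
Proof.
move=> T0; apply/cvgrPdist_le => e e0.
have cs : {within `[0, T], continuous (fun s => sin (T - s) ^+ 2)}.
  apply: continuous_subspaceT => s.
  apply/differentiable_continuous/derivable1_diffP.
  exact: ex_derive.
have [delta d0 unif] := segment_uniformly_continuous _ _ _ _ (e / T) cs (divr_gt0 e0 T0).
near=> n; have nd : T / n.+1%:R < delta.
  by near: n; exact: mesh_step_eventually_small.
rewrite (le_trans (sin_square_riemann_sum _ T n.+1 T0 _ (e / T) _))//.
  by move=> s s' sT s'T ss'; apply: unif => //; exact: le_lt_trans nd.
by rewrite divfK// gt_eqF.
Unshelve. all: by end_near. Qed.

(** * Moment generating function of the oscillator *)

Section oscillator_mgf.
Context (R : realType) (d : measure_display) (Omega : measurableType d)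
  (P : probability Omega R) (F : R -> set (set Omega)) (W : R -> Omega -> R)
  (alpha x0 y0 : R) (X Y : R -> Omega -> R).
Hypothesis hF : complete_filtration P F.
Hypothesis hW : brownian_motion P F W.
Hypothesis alpha_gt0 : 0 < alpha.
Hypothesis hXY : oscillator_solution P F W alpha x0 y0 X Y.
Context (T : R).
Hypothesis T_gt0 : 0 < T.

Let m := x0 * cos T + y0 * sin T.

Let S n w := \sum_(i < n.+1) sin (T - mesh R T n.+1 i) *
  (W (mesh R T n.+1 i.+1) w - W (mesh R T n.+1 i) w).

Let v n := \sum_(i < n.+1) sin (T - mesh R T n.+1 i) ^+ 2 *
    (mesh R T n.+1 i.+1 - mesh R T n.+1 i).

Let mesh_lt n i : mesh R T n.+1 i < mesh R T n.+1 i.+1.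
Proof. by rewrite ltr_pM2r ?ltr_nat// divr_gt0. Qed.

Let mesh_ge0 n i : 0 <= mesh R T n.+1 i.
Proof. by rewrite mulr_ge0// divr_ge0// ltW. Qed.

Let measurable_S n : measurable_fun setT (S n).
Proof.
apply: measurable_sum => i; apply: measurable_funM => //.
by apply: measurable_funB; apply: (adapted_measurable_fun _ _ _ _ _ hF) => //;
  exact: (brownian_adapted hW).
Qed.

Let S_mgf n l : (\int[P]_w (expR (l * (m + alpha * S n w)))%:E =
  (expR (l * m + l ^+ 2 * (alpha ^+ 2 * v n) / 2))%:E)%E.
Proof.
pose c i := l * alpha * sin (T - mesh R T n.+1 i).
transitivity (\int[P]_w ((expR (l * m))%:E * (expR (\sum_(i < n.+1) c i *
  (W (mesh R T n.+1 i.+1) w - W (mesh R T n.+1 i) w)))%:E))%E.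
  apply: eq_integral => w _; rewrite -EFinM -expRD mulrDr mulrA; congr (expR (_ + _))%:E.
  by rewrite mulr_sumr; apply: eq_bigr => i _; rewrite /c !mulrA.
rewrite ge0_integralZl//.
- rewrite (brownian_sum_mgf _ _ _ _ _ _ hF hW (mesh R T n.+1) c)//.
  rewrite -EFinM -expRD; congr (expR (_ + _))%:E.
  rewrite mulrA [RHS]mulrAC mulr_sumr; apply: eq_bigr => i _.
  by rewrite /c; field.
- apply/measurable_EFinP; apply: measurableT_comp => //.
  apply: measurable_sum => i; apply: measurable_funM => //.
  by apply: measurable_funB; apply: (adapted_measurable_fun _ _ _ _ _ hF) => //;
    exact: (brownian_adapted hW).
Qed.

(** All almost sure properties are first collected at one [w]; the rest is deterministic, by
    [oscillator_path_approx] and uniform continuity of the Brownian path on the segment. *)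
Let S_cvg : {ae P, forall w, m + alpha * S n w @[n --> \oo] --> X T w}.
Proof.
near=> w.
have cX : {within `[0, +oo[, continuous (X^~ w)}.
  by near: w; exact: (oscillator_continuous_X hXY).
have cY : {within `[0, +oo[, continuous (Y^~ w)}.
  by near: w; exact: (oscillator_continuous_Y hXY).
have cW : {within `[0, +oo[, continuous (W^~ w)}.
  by near: w; exact: (brownian_continuous hW).
have W0 : W 0 w = 0 by near: w; exact: (brownian_start hW).
have XE : forall t : R, 0 <= t ->
    X t w = x0 + \int[lebesgue_measure]_(s in `[0, t]) Y s w.
  by near: w; exact: (oscillator_X hXY).
have YE : forall t : R, 0 <= t ->
    Y t w = y0 - \int[lebesgue_measure]_(s in `[0, t]) X s w + alpha * W t w.
  by near: w; exact: (oscillator_Y hXY).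
apply/cvgrPdist_le => e e0.
have cWT : {within `[0, T], continuous (W^~ w)}.
  apply: continuous_subspaceW cW => s /=.
  by rewrite !in_itv/= andbT => /andP[].
(* This oscillation of the Brownian path turns the error bound [alpha * e * T] of
   [oscillator_path_approx] into the given [e]. *)
have e1 : 0 < e / (alpha * T) by rewrite divr_gt0// mulr_gt0.
have [delta d0 unif] := segment_uniformly_continuous _ _ _ _ _ cWT e1.
near=> n; have nd : T / n.+1%:R < delta.
  by near: n; exact: mesh_step_eventually_small.
rewrite opprD addrA (le_trans (oscillator_path_approx _ T n.+1 T_gt0 _ alpha x0 y0
  (e / (alpha * T)) (X^~ w) (Y^~ w) (W^~ w) _ _ _ _ _ _ _ _))//.
  by move=> s s' sT s'T ss'; apply: unif => //; exact: le_lt_trans nd.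
rewrite le_eqVlt; apply/orP; left; apply/eqP; field.
by rewrite !gt_eqF.
Unshelve. all: by end_near. Qed.

(** The square of the exponential with parameter [l] is the exponential with parameter [2 * l], so
    [S_mgf] yields first and second moments alike, and both converge with the Riemann sums of the
    squared sine. *)
Lemma oscillator_mgf (l : R) : (\int[P]_w (expR (l * X T w))%:E =
  (expR (l * m + l ^+ 2 * (alpha ^+ 2 * ((T - sin T * cos T) / 2)) / 2))%:E)%E.
Proof.
have sq (a : R) : expR a ^+ 2 = expR (2 * a) by rewrite expr2 -expRD; congr expR; ring.
have vE (k : R) : expR (k * m + k ^+ 2 * (alpha ^+ 2 * v n) / 2) @[n --> \oo] -->
    expR (k * m + k ^+ 2 * (alpha ^+ 2 * ((T - sin T * cos T) / 2)) / 2).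
  suff h : k * m + k ^+ 2 * (alpha ^+ 2 * v n) / 2 @[n --> \oo] -->
      k * m + k ^+ 2 * (alpha ^+ 2 * ((T - sin T * cos T) / 2)) / 2.
    exact: (cvg_comp _ _ h (@continuous_expR R _)).
  apply: cvgD; first exact: cvg_cst.
  apply: cvgM; last exact: cvg_cst.
  apply: cvgM; first exact: cvg_cst.
  apply: cvgM; first exact: cvg_cst.
  exact: sin_square_riemann_sum_cvg.
apply: (second_moment_integral_cvg _ _ _ P
  (fun n w => expR (l * (m + alpha * S n w))) _
  (fun n => expR (l * m + l ^+ 2 * (alpha ^+ 2 * v n) / 2))
  (fun n => expR (2 * l * m + (2 * l) ^+ 2 * (alpha ^+ 2 * v n) / 2)) _ _
  _ _ _ _ _ _ _ (vE l) (vE (2 * l))).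
- move=> n; apply: measurableT_comp => //; apply: measurable_funM => //.
  by apply: measurable_funD => //; apply: measurable_funM.
- apply: measurableT_comp => //; apply: measurable_funM => //.
  apply: (adapted_measurable_fun _ _ _ _ _ hF) => //; last exact: ltW.
  exact: (oscillator_adapted_X hXY).
- by move=> n w; exact: expR_ge0.
- by move=> w; exact: expR_ge0.
- apply: filterS S_cvg => w Sw.
  have h : l * (m + alpha * S n w) @[n --> \oo] --> l * X T w.
    by apply: cvgM => //; exact: cvg_cst.
  exact: (cvg_comp _ _ h (@continuous_expR R _)).
- by move=> n; exact: S_mgf.
- move=> n; rewrite -S_mgf; apply: eq_integral => w _.
  by rewrite sq mulrA.
Qed.

End oscillator_mgf.

Theorem theorem2p6 (R : realType) (d : measure_display)
    (Omega : measurableType d) (P : probability Omega R)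
    (F : R -> set (set Omega)) (W : R -> Omega -> R)
    (alpha x0 y0 : R) (X Y : R -> Omega -> R)
    (hF : complete_filtration P F)
    (hW : brownian_motion P F W)
    (halpha : 0 < alpha)
    (hXY : oscillator_solution P F W alpha x0 y0 X Y) :
  let J := fun y : R => (y ^+ 2 / alpha ^+ 2)%:E in
  let B := fun (T : R) (w : Omega) => X T w / T in
  good_rate_function J /\ large_deviations_principle P B J.
Proof.
move=> J B; have a2 : 0 < alpha ^+ 2 by rewrite exprn_gt0.
split; first exact: quadratic_good_rate_function.
(* The variance of [X T] grows like [c * T] with [c] equal to [alpha ^+ 2 / 2]; the deviation is
   [alpha ^+ 2 / 2] times the product of a sine and a cosine, which gives the last constant passed
   to [gaussian_mgf_ldp]. *)
have -> : J = fun y => (y ^+ 2 / (2 * (alpha ^+ 2 / 2)))%:E.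
  by apply/funext => y; rewrite /J; congr (_ / _)%:E; field.
apply: (gaussian_mgf_ldp _ _ _ P X (fun T => x0 * cos T + y0 * sin T)
  (fun T => alpha ^+ 2 * ((T - sin T * cos T) / 2)) _
  (`|x0| + `|y0|) (alpha ^+ 2 / 2)).
- by rewrite divr_gt0.
- move=> T T0; apply: (adapted_measurable_fun _ _ _ _ _ hF) => //; last exact: ltW.
  exact: (oscillator_adapted_X hXY).
- by move=> T l T0; exact: (oscillator_mgf _ _ _ _ _ _ _ _ _ _ _ hF hW halpha hXY).
- move=> T T0; rewrite (le_trans (ler_normD _ _))// !normrM lerD//.
    by rewrite ler_piMr// cos_max.
  by rewrite ler_piMr// sin_max.
- move=> T T0.
  have -> : alpha ^+ 2 * ((T - sin T * cos T) / 2) - alpha ^+ 2 / 2 * T =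
      alpha ^+ 2 / 2 * - (sin T * cos T) by field.
  have a0 : 0 <= alpha ^+ 2 / 2 by rewrite divr_ge0// ltW.
  rewrite normrM ger0_norm// ler_piMr//.
  by rewrite normrN normrM mulr_ile1 ?sin_max ?cos_max.
Qed.
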